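(* If $N$ is a power of a prime, then $N^{3/4}\le B(N)$.
   Context: An orthogonal array $OA(N, s_1^{k_1} s_2^{k_2}\cdots s_v^{k_v})$ (of strength 2) is an $N\times k$ array, $k=k_1+\cdots+k_v$, whose first $k_1$ columns have entries from $\{0,\dots,s_1-1\}$, next $k_2$ columns entries from $\{0,\dots,s_2-1\}$, etc., such that in every $N\times 2$ subarray every possible ordered pair of symbols occurs equally often as a row; here $2\le s_1<s_2<\cdots$ and $k_i\ge 1$. A (putative) parameter set is a symbol $(N,s_1^{k_1}s_2^{k_2}\cdots)$ satisfying: (C1) each $s_i$ divides $N$; (C2) $s_i^2$ divides $N$ whenever $k_i\ge 2$; (C3) $s_is_j$ divides $N$ for $i\ne j$; (C4) $N-1\ge k_1(s_1-1)+k_2(s_2-1)+\cdots$. Its number of degrees of freedom is $k_1(s_1-1)+k_2(s_2-1)+\cdots$. It is realized if an $OA(N,s_1^{k_1}s_2^{k_2}\cdots)$ exists. The threshold function $B(N)$ is the maximum integer $b$ such that every parameter set with $N$ runs having at most $b$ degrees of freedom is realized, while some parameter set with $b+1$ degrees of freedom is not realized; if every parameter set with $N$ runs is realized, $B(N)=N-1$.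
   Formalization: The formal statement assumes N > 3, because the claim fails at the prime powers N = 2 and N = 3, where B(2) = 1 < 2^{3/4} and B(3) = 2 < 3^{3/4}; all other prime powers p^e with e ≥ 1 are covered. *)

(* Defs.v *)
From HB Require Import structures.
From mathcomp Require Import all_boot all_order all_algebra.
From mathcomp Require Import boolp.

Set Implicit Arguments.
Unset Strict Implicit.
Unset Printing Implicit Defensive.

(* [:: (s_1, k_1); ...; (s_v, k_v)] stands for the symbol s_1^k_1 ... s_v^k_v.
   The empty symbol is allowed; it has 0 degrees of freedom and is always
   realized, so it does not affect the threshold. *)
Definition symbol := seq (nat * nat).

Definition deg_freedom (ps : symbol) : nat := \sum_(x <- ps) x.2 * (x.1 - 1).

Definition wf_symbol (ps : symbol) : Prop :=
  sorted ltn (unzip1 ps) /\ (forall x, x \in ps -> 2 <= x.1 /\ 1 <= x.2).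

(* The s_i are pairwise distinct in a well-formed symbol, so in the third
   divisibility condition [x != y] says that the indices differ. *)
Definition parameter_set (N : nat) (ps : symbol) : Prop :=
  [/\ wf_symbol ps,
      (forall x, x \in ps -> x.1 %| N),
      (forall x, x \in ps -> 2 <= x.2 -> x.1 ^ 2 %| N),
      (forall x y, x \in ps -> y \in ps -> x != y -> x.1 * y.1 %| N)
    & deg_freedom ps <= N - 1].

(* Number of levels of each column: s_1 repeated k_1 times, then s_2, etc. *)
Definition col_levels (ps : symbol) : seq nat :=
  flatten [seq nseq x.2 x.1 | x <- ps].

Definition pair_count (N k : nat) (A : 'M[nat]_(N, k)) (j1 j2 : 'I_k)
    (a b : nat) : nat :=
  #|[set i : 'I_N | (A i j1 == a) && (A i j2 == b)]|.

Definition orthogonal_array (N : nat) (lv : seq nat)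
    (A : 'M[nat]_(N, size lv)) : Prop :=
  (forall i j, A i j < nth 0 lv j) /\
  (forall j1 j2 : 'I_(size lv), j1 != j2 ->
   forall a b a' b' : nat,
     a < nth 0 lv j1 -> b < nth 0 lv j2 ->
     a' < nth 0 lv j1 -> b' < nth 0 lv j2 ->
     pair_count A j1 j2 a b = pair_count A j1 j2 a' b').

Definition realized (N : nat) (ps : symbol) : Prop :=
  exists A : 'M[nat]_(N, size (col_levels ps)), orthogonal_array A.

Definition all_realized (N : nat) : Prop :=
  forall ps, parameter_set N ps -> realized N ps.

Definition threshold_at (N b : nat) : Prop :=
  (forall ps, parameter_set N ps -> deg_freedom ps <= b -> realized N ps) /\
  (exists ps, [/\ parameter_set N ps, deg_freedom ps = b.+1
                & ~ realized N ps]).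

(* The bound b < N loses nothing: see [threshold_at_lt]. *)
Definition threshold (N : nat) : nat :=
  if `[< all_realized N >] then N - 1
  else \max_(b < N | `[< threshold_at N b >]) b.

Lemma threshold_at_lt (N b : nat) : threshold_at N b -> b < N.
Proof.
case=> _ [ps [[_ _ _ _ h] e _]]; move: h; rewrite e => h.
exact: leq_trans h (leq_subr 1 N).
Qed.

Lemma threshold_at_uniq (N b c : nat) :
  threshold_at N b -> threshold_at N c -> b = c.
Proof.
move=> [hb [ps [pb eb nb]]] [hc [qs [pc ec nc]]].
case: (ltngtP b c) => // h.
- by case: nb; apply: hc; rewrite ?eb.
- by case: nc; apply: hb; rewrite ?ec.
Qed.

Lemma realized_nil (N : nat) : realized N [::].
Proof. by exists (const_mx 0); split=> [i []|[]]. Qed.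

Lemma deg_freedom_gt0 (ps : symbol) :
  wf_symbol ps -> ps <> [::] -> 0 < deg_freedom ps.
Proof.
case: ps => // -[s k] ps [_ h] _; rewrite /deg_freedom big_cons /=.
have [hs hk] := h (s, k) (mem_head _ _).
by rewrite addn_gt0 muln_gt0 subn_gt0 hs hk.
Qed.

Lemma thresholdP (N : nat) : ~ all_realized N -> threshold_at N (threshold N).
Proof.
move=> nall.
pose P d := `[< exists ps,
  [/\ parameter_set N ps, deg_freedom ps = d & ~ realized N ps] >].
have exP : exists d, P d.
  apply: contrapT => nP; apply: nall => ps hps; apply: contrapT => nr.
  by apply: nP; exists (deg_freedom ps); apply/asboolP; exists ps.
have [[|b] /asboolP[ps [hps e nr]] bmin] := ex_minnP exP.
  have wf : wf_symbol ps by case: hps.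
  have /(deg_freedom_gt0 wf) : ps <> [::].
    by move=> ps0; apply: nr; rewrite ps0; exact: realized_nil.
  by rewrite e.
have hb : threshold_at N b.
  split; last by exists ps.
  move=> qs hqs le_qs; apply: contrapT => nqs.
  have /bmin : P (deg_freedom qs) by apply/asboolP; exists qs.
  by rewrite leqNgt ltnS le_qs.
suff -> : threshold N = b by [].
rewrite /threshold asboolF //.
apply/eqP; rewrite eqn_leq; apply/andP; split.
  by apply/bigmax_leqP => c /asboolP hc; rewrite (threshold_at_uniq hc hb).
exact: (@leq_bigmax_cond _ _ _ (Ordinal (threshold_at_lt hb)) (asboolT hb)).
Qed.

(* Main.v *)
Require Import Defs.
From mathcomp Require Import all_boot all_order all_algebra.
From mathcomp Require Import reals exp.
From mathcomp Require Import fingroup cyclic all_field mxabelem zify boolp.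

(** Let [F] be a field with [q] elements and let subspaces of [F ^ n] of
    dimensions [a_1, ..., a_k] meet pairwise trivially.  The dual linear maps
    are then the columns of an orthogonal array with [q ^ n] runs and [q ^ a_j]
    levels, so it is enough to pack subspaces.  Let [d] be the number of degrees
    of freedom, with [(d - 1) ^ 4 < q ^ (3 * n)], as is the case for
    [d - 1 < N ^ (3 / 4)] when [N = q ^ n].  Subspaces of dimension [a] with
    [4 * (a - 1) <= n] can be added greedily, spanning vector by vector: at most
    [q ^ (a - 1) * (d' + 1) < q ^ n] vectors have to be avoided, where [d'] is
    the number of nonzero vectors covered so far.  The remaining, larger
    subspaces number at most [q ^ m] whenever [n <= 2 * m], so they fit in
    distinct members of a partial spread made of one subspace of dimension [m]
    and [q ^ m] subspaces of dimension [n - m], where [m] is the larger of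
    [n / 2] (rounded up) and the biggest dimension. *)

Set Implicit Arguments.
Unset Strict Implicit.
Unset Printing Implicit Defensive.

Import GRing.Theory Num.Theory FinRing.Theory VectorInternalTheory.

Local Open Scope ring_scope.

Definition mxdisjoint {F : fieldType} {m1 m2 n : nat} (A : 'M[F]_(m1, n))
    (B : 'M[F]_(m2, n)) : bool :=
  (A :&: B)%MS == 0.

Section MatrixDisjointness.

Context {F : fieldType} {n : nat}.

Lemma mxdisjointP {m1 m2 : nat} (A : 'M[F]_(m1, n)) (B : 'M[F]_(m2, n)) :
  reflect (forall v : 'rV_n, (v <= A)%MS -> (v <= B)%MS -> v = 0)
          (mxdisjoint A B).
Proof.
apply: (iffP (@rowV0P _ _ _ _)) => disj v.
  by move=> vA vB; apply: disj; rewrite sub_capmx vA.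
by rewrite sub_capmx => /andP[]; apply: disj.
Qed.

Lemma mxdisjoint_sym {m1 m2 : nat} (A : 'M[F]_(m1, n)) (B : 'M[F]_(m2, n)) :
  mxdisjoint A B = mxdisjoint B A.
Proof. by rewrite /mxdisjoint capmxC. Qed.

Lemma mxdisjointS {m1 m2 m3 m4 : nat} (A : 'M[F]_(m1, n)) (A' : 'M[F]_(m2, n))
    (B : 'M[F]_(m3, n)) (B' : 'M[F]_(m4, n)) :
  (A' <= A)%MS -> (B' <= B)%MS -> mxdisjoint A B -> mxdisjoint A' B'.
Proof.
move=> sA sB /mxdisjointP disj; apply/mxdisjointP => v vA vB.
exact: disj (submx_trans vA sA) (submx_trans vB sB).
Qed.

Lemma mxdisjoint_rank {m1 m2 : nat} (A : 'M[F]_(m1, n)) (B : 'M[F]_(m2, n)) :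
  mxdisjoint A B = (\rank (A + B) == \rank A + \rank B)%N.
Proof. by rewrite mxrank_adds_leqif submx0. Qed.

Lemma mxdisjoint_genmx {m1 m2 : nat} (A : 'M[F]_(m1, n)) (B : 'M[F]_(m2, n)) :
  mxdisjoint <<A>>%MS <<B>>%MS = mxdisjoint A B.
Proof.
by rewrite !mxdisjoint_rank (adds_eqmx (genmxE A) (genmxE B)) !genmxE.
Qed.

Lemma mxrank_adds_row {m : nat} (A : 'M[F]_(m, n)) (v : 'rV_n) :
  ~~ (v <= A)%MS -> \rank (A + v) = (\rank A).+1.
Proof.
move=> vA; have v_neq0 : v != 0 by apply: contraNneq vA => ->; exact: sub0mx.
rewrite mxrank_disjoint_sum ?rank_rV ?v_neq0 ?addn1 //.
apply/eqP/mxdisjointP => u uA /sub_rVP[c uE]; apply/eqP.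
move: uA; rewrite uE; have [-> _|c_neq0] := eqVneq c 0.
  by rewrite scale0r.
by rewrite (eqmx_scale _ c_neq0) (negPf vA).
Qed.

Lemma mxdisjoint_adds_row {m1 m2 : nat} (A : 'M[F]_(m1, n)) (B : 'M[F]_(m2, n))
    (v : 'rV_n) :
  mxdisjoint A B -> ~~ (v <= A + B)%MS -> mxdisjoint (A + v)%MS B.
Proof.
rewrite !mxdisjoint_rank => /eqP rank_AB vAB.
have vA : ~~ (v <= A)%MS.
  by apply: contra vAB => vA; rewrite (submx_trans vA) ?addsmxSl.
rewrite -addsmxA [(v + B)%MS]addsmxC addsmxA !mxrank_adds_row // rank_AB.
by rewrite addSn.
Qed.

Lemma row_full_row_mx_disjoint {m1 m2 : nat} (A : 'M[F]_(m1, n))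
    (B : 'M[F]_(m2, n)) :
  row_free A -> row_free B -> mxdisjoint A B -> row_full (row_mx A^T B^T).
Proof.
move=> /eqP rankA /eqP rankB; rewrite mxdisjoint_rank rankA rankB.
by rewrite /row_full -tr_col_mx mxrank_tr -addsmxE.
Qed.

Lemma exists_submx_rank {m : nat} (A : 'M[F]_(m, n)) (a : nat) :
  (a <= \rank A)%N -> exists2 B : 'M[F]_n, (B <= A)%MS & \rank B = a.
Proof.
move=> le_a; exists <<(pid_mx a : 'M_(a, _)) *m row_base A>>%MS.
  by rewrite genmxE (submx_trans (submxMl _ _)) ?eq_row_base.
by rewrite genmxE mxrankMfree ?row_base_free // rank_pid_mx.
Qed.

End MatrixDisjointness.

Definition mxpackable (F : fieldType) (n : nat) (dims : seq nat) : Prop :=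
  exists2 fam : seq 'M[F]_n, pairwise mxdisjoint fam
    & [seq \rank G | G <- fam] = dims.

Lemma mxpackable_leq (F : fieldType) (n : nat) (dims dims' : seq nat) :
    mxpackable F n dims' -> (size dims <= size dims')%N ->
    (forall i, (i < size dims)%N -> (nth 0 dims i <= nth 0 dims' i)%N) ->
  mxpackable F n dims.
Proof.
case=> fam /(pairwiseP 0) disj <-; rewrite size_map => le_size le_dims.
have /choice[sub subP] i : exists G : 'M[F]_n, (i < size dims)%N ->
    (G <= nth 0 fam i)%MS /\ \rank G = nth 0%N dims i.
  have [lt_i|_] := boolP (i < size dims)%N; last by exists 0.
  have := le_dims i lt_i; rewrite (nth_map 0) ?(leq_trans lt_i) //.
  by case/exists_submx_rank => G sG rG; exists G.
exists (mkseq sub (size dims)).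
  apply/(pairwiseP 0) => i j; rewrite !inE size_mkseq => lt_i lt_j lt_ij.
  rewrite !nth_mkseq //.
  have [[sub_i _] [sub_j _]] := (subP i lt_i, subP j lt_j).
  apply: mxdisjointS sub_i sub_j _.
  exact: disj (leq_trans lt_i le_size) (leq_trans lt_j le_size) lt_ij.
apply: (@eq_from_nth _ 0%N) => [|i]; rewrite size_map size_mkseq // => lt_i.
by rewrite (nth_map 0) ?size_mkseq // nth_mkseq //; case: (subP i lt_i).
Qed.

(* The number of degrees of freedom of columns with [q ^ a] levels, for [a] in
   [dims]; also the number of nonzero vectors in a packing of type [dims]. *)
Definition dims_freedom (q : nat) (dims : seq nat) : nat :=
  (\sum_(a <- dims) (q ^ a - 1))%N.

Lemma card_rV (F : finFieldType) (n : nat) : #|{: 'rV[F]_n}| = (#|F| ^ n)%N.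
Proof. by rewrite card_mx mul1n. Qed.

Section GreedyPacking.

Context {F : finFieldType} {n : nat}.

Lemma card_rowg_addsD (A B : 'M[F]_n) :
  mxdisjoint A B ->
  #|rowg (A + B)%MS :\: rowg A| = (#|F| ^ \rank A * (#|F| ^ \rank B - 1))%N.
Proof.
rewrite mxdisjoint_rank => /eqP rankAB.
have sub_adds : rowg A \subset rowg (A + B)%MS by rewrite rowgS addsmxSl.
rewrite cardsD (setIidPr sub_adds) !card_rowg rankAB.
by rewrite expnD mulnBr muln1.
Qed.

Lemma card_rowg_adds_family (A : 'M[F]_n) (fam : seq 'M[F]_n) :
  all (mxdisjoint A) fam ->
  (#|rowg A :|: [set v | has (fun G => (v <= A + G)%MS) fam]|
    <= #|F| ^ \rank A * (1 + dims_freedom #|F| [seq \rank G | G <- fam]))%N.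
Proof.
rewrite /dims_freedom big_map; elim: fam => [_|G fam IH] /=.
  rewrite big_nil muln1 -card_rowg subset_leq_card // subUset subxx.
  by apply/subsetP=> v; rewrite inE.
case/andP=> AG /IH {}IH; rewrite big_cons addnCA mulnDr -card_rowg_addsD //.
apply: leq_trans (leq_add (leqnn _) IH); apply: leq_trans (leq_card_setU _ _).
apply/subset_leq_card/subsetP=> v; rewrite !inE.
by case: (v <= A)%MS; rewrite /= ?orbT.
Qed.

Lemma exists_row_avoiding (A : 'M[F]_n) (fam : seq 'M[F]_n) :
    all (mxdisjoint A) fam ->
    (#|F| ^ \rank A * (1 + dims_freedom #|F| [seq \rank G | G <- fam])
      < #|F| ^ n)%N ->
  exists2 v : 'rV[F]_n, ~~ (v <= A)%MS
    & all (fun G => ~~ (v <= A + G)%MS) fam.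
Proof.
move=> /card_rowg_adds_family le_card /(leq_ltn_trans le_card) lt_card.
have /subsetPn[v _] : ~~ ([set: 'rV[F]_n] \subset
    rowg A :|: [set v | has (fun G => (v <= A + G)%MS) fam]).
  apply: contraL lt_card => /subset_leq_card.
  by rewrite cardsT card_rV -leqNgt.
by rewrite !inE negb_or -all_predC => /andP[vA v_fam]; exists v.
Qed.

Lemma exists_mxdisjoint_rank (fam : seq 'M[F]_n) (a : nat) :
    (#|F| ^ a.-1 * (1 + dims_freedom #|F| [seq \rank G | G <- fam])
      < #|F| ^ n)%N ->
  exists2 A : 'M[F]_n, \rank A = a & all (mxdisjoint A) fam.
Proof.
elim: a => [|a IH] lt_n.
  exists 0; first exact: mxrank0.
  by apply/allP=> G _; rewrite /mxdisjoint cap0mx.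
have [|A rankA disjA] := IH.
  apply: leq_ltn_trans lt_n; rewrite leq_mul2r leq_exp2l ?leq_pred ?orbT //.
  exact: finNzRing_gt1.
have [|v vA v_fam] := exists_row_avoiding disjA; first by rewrite rankA.
exists (A + v)%MS; first by rewrite mxrank_adds_row ?rankA.
apply/allP=> G G_fam.
exact: mxdisjoint_adds_row (allP disjA G G_fam) (allP v_fam G G_fam).
Qed.

Lemma mxpackable_cons (dims : seq nat) (a : nat) :
    mxpackable F n dims ->
    (#|F| ^ a.-1 * (1 + dims_freedom #|F| dims) < #|F| ^ n)%N ->
  mxpackable F n (a :: dims).
Proof.
case=> fam disj <- /exists_mxdisjoint_rank[A rankA disjA].
by exists (A :: fam); rewrite /= ?disjA ?rankA.
Qed.

End GreedyPacking.

Lemma natr_card_finField (F : finFieldType) : #|F|%:R = 0 :> F.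
Proof. by rewrite -zmodXgE -cardsT expg_cardG ?inE. Qed.

Lemma size_XnsubX (R : nzRingType) (m : nat) :
  (1 < m)%N -> size ('X^m - 'X : {poly R}) = m.+1.
Proof.
by move=> m_gt1; rewrite size_polyDl ?size_polyXn // size_polyN size_polyX ltnS.
Qed.

Lemma separable_XnsubX (F : fieldType) (m : nat) :
  m%:R = 0 :> F -> separable_poly ('X^m - 'X : {poly F}).
Proof.
move=> m0; rewrite separable_poly.unlock derivB derivXn derivX.
rewrite -mulr_natr -polyC_natr m0 mulr0 sub0r.
apply/Bezout_eq1_coprimepP; exists (0, -1).
by rewrite mul0r add0r mulrNN mulr1.
Qed.

(* In the splitting field of ['X^m - 'X] the roots are the points fixed by the
   [n]-th power of the Frobenius automorphism, hence they exhaust the field. *)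
Lemma finField_extension (F : finFieldType) (n : nat) :
  (0 < n)%N -> exists L : fieldExtType F, \dim {:L} = n.
Proof.
move=> n_gt0; set m := (#|F| ^ n)%N.
have m_gt1 : (1 < m)%N by rewrite -(exp1n n) ltn_exp2r ?finNzRing_gt1.
have /FinSplittingFieldFor[L] : 'X^m - 'X != 0 :> {poly F}.
  by rewrite -size_poly_eq0 size_XnsubX.
rewrite rmorphB rmorphXn /= map_polyX => -[zs zs_eqp defL].
have m0 : m%:R = 0 :> L.
  rewrite -(rmorph_nat (in_alg L)) natrX natr_card_finField.
  by rewrite expr0n gtn_eqF // rmorph0.
have zs_uniq : uniq zs.
  by rewrite -separable_prod_XsubC -(eqp_separable zs_eqp) separable_XnsubX.
have size_zs : size zs = m.
  apply: succn_inj; rewrite -(size_prod_XsubC _ id) -(eqp_size zs_eqp).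
  exact: size_XnsubX.
have [a _ aE] := finField_galois_generator (sub1v {:L}).
have anE z : (a ^+ n)%g z = z ^+ m.
  rewrite /m; elim: (n) => [|i IHi]; first by rewrite gal_id expr1.
  by rewrite expgSr expnSr exprM -IHi galM ?memvf // aE ?memvf // dimv1 expn1.
have fixE z : (z \in fixedField [set (a ^+ n)%g]) = (z \in zs).
  rewrite -root_prod_XsubC -(eqp_root zs_eqp) /root !hornerE subr_eq0 -anE.
  apply/(fixedFieldP (memvf z))/eqP=> [az | az b /set1P-> //].
  by apply: az; rewrite set11.
have fixL : fixedField [set (a ^+ n)%g] = {:L}%VS.
  apply/eqP; rewrite eqEsubv subvf -defL; apply/Fadjoin_seqP; split=> [|z].
    exact: sub1v.
  by rewrite fixE.
exists L; apply: (@expnI #|F|); first exact: finNzRing_gt1.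
rewrite -(@card_vspace F (finvect_type L)) -/m -size_zs.
rewrite -(card_uniqP (zs_uniq : uniq (zs : seq (finvect_type L)))).
by apply: eq_card => z; rewrite -fixE fixL.
Qed.

Definition mx_spread_set {F : fieldType} {m : nat} (s : seq 'M[F]_m) : bool :=
  pairwise (fun X Y => X - Y \in unitmx) s.

(* The witnesses are the multiplications by the elements of the extension of
   degree [m] of [F]. *)
Lemma exists_mx_spread_set (F : finFieldType) (m k : nat) :
    (0 < m)%N -> (k <= #|F| ^ m)%N ->
  exists2 s : seq 'M[F]_m, size s = k & mx_spread_set s.
Proof.
move=> /(finField_extension F)[L dimL] le_k.
rewrite dimvf in dimL; rewrite -{m}dimL in le_k *.
pose mulL (x : L) : 'M[F]_(dim L) := lin1_mx (v2r \o (x \*o r2v)).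
have mulLE x u : u *m mulL x = v2r (x * r2v u) by rewrite mul_rV_lin1.
have mulL_unit (x y : L) : x != y -> mulL x - mulL y \in unitmx.
  move=> neq_xy; rewrite -row_free_unit; apply: inj_row_free => u.
  rewrite mulmxBr !mulLE -raddfB -mulrBl => xy_u0.
  have /eqP : (x - y) * r2v u = 0 by apply: v2r_inj; rewrite xy_u0 raddf0.
  rewrite mulf_eq0 subr_eq0 (negPf neq_xy) => /eqP u0.
  by rewrite -[u]r2vK u0 raddf0.
have card_L : size (enum (finvect_type L)) = (#|F| ^ dim L)%N.
  by rewrite -cardE -dimvf -(@card_vspace _ (finvect_type L)) card_vspacef.
pose elts : seq L := take k (enum (finvect_type L)).
exists [seq mulL x | x <- elts]; first by rewrite size_map size_takel ?card_L.
have : uniq elts by apply: take_uniq; apply: enum_uniq.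
rewrite uniq_pairwise /mx_spread_set pairwise_map.
by apply: sub_pairwise => x y; apply: mulL_unit.
Qed.

Section GraphSubspaces.

Context {F : fieldType} {b m : nat}.

Definition graph_mx (P : 'M[F]_(b, m)) : 'M[F]_(b, b + m) := row_mx 1%:M P.

Definition vertical_mx : 'M[F]_(m, b + m) := row_mx 0 1%:M.

Lemma sub_graph_mx (P : 'M[F]_(b, m)) (v : 'rV_(b + m)) :
  (v <= graph_mx P)%MS -> exists u : 'rV_b, v = row_mx u (u *m P).
Proof.
by case/submxP=> u ->; exists u; rewrite /graph_mx mul_mx_row mulmx1.
Qed.

Lemma mxrank_graph (P : 'M[F]_(b, m)) : \rank (graph_mx P) = b.
Proof.
apply/eqP/row_freeP; exists (col_mx 1%:M 0).
by rewrite mul_row_col mulmx0 mulmx1 addr0.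
Qed.

Lemma mxrank_vertical : \rank vertical_mx = m.
Proof.
apply/eqP/row_freeP; exists (col_mx 0 1%:M).
by rewrite mul_row_col mul0mx mulmx1 add0r.
Qed.

Lemma mxdisjoint_graph (P Q : 'M[F]_(b, m)) :
  row_free (P - Q) -> mxdisjoint (graph_mx P) (graph_mx Q).
Proof.
move=> free_PQ; apply/mxdisjointP => v /sub_graph_mx[u ->] /sub_graph_mx[w].
case/eq_row_mx=> <- /eqP.
rewrite -subr_eq0 -mulmxBr mulmx_free_eq0 // => /eqP->.
by rewrite mul0mx row_mx0.
Qed.

Lemma mxdisjoint_graph_vertical (P : 'M[F]_(b, m)) :
  mxdisjoint (graph_mx P) vertical_mx.
Proof.
apply/mxdisjointP => v /sub_graph_mx[u ->] /submxP[w].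
rewrite mul_mx_row mulmx0 => /eq_row_mx[-> _].
by rewrite mul0mx row_mx0.
Qed.

End GraphSubspaces.

Lemma mxpackable_of_spread_set (F : fieldType) (b m : nat) (s : seq 'M[F]_m) :
    (b <= m)%N -> mx_spread_set s ->
  mxpackable F (b + m) (rcons (nseq (size s) b) m).
Proof.
move=> le_bm spread_s.
pose P : 'M[F]_(b, m) := pid_mx b.
have free_P : row_free P by rewrite /row_free rank_pid_mx.
pose G X : 'M[F]_(b + m) := <<graph_mx (P *m X)>>%MS.
exists (rcons [seq G X | X <- s] <<vertical_mx>>%MS); last first.
  rewrite map_rcons genmxE mxrank_vertical -map_comp; congr rcons.
  by elim: s {spread_s} => //= X s ->; rewrite genmxE mxrank_graph.
rewrite pairwise_rcons pairwise_map; apply/andP; split.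
  apply/allP=> _ /mapP[X _ ->].
  by rewrite mxdisjoint_genmx mxdisjoint_graph_vertical.
apply: sub_pairwise spread_s => X Y /= unitXY; rewrite mxdisjoint_genmx.
apply: mxdisjoint_graph.
by rewrite -mulmxBr /row_free mxrankMfree ?row_free_unit.
Qed.

Lemma mxpackable_rcons_of_spread (F : finFieldType) (n m a : nat)
    (dims : seq nat) :
    (0 < m <= n)%N -> (n <= m.*2)%N -> (size dims <= #|F| ^ m)%N ->
    all (fun c => (c <= n - m)%N) dims -> (a <= m)%N ->
  mxpackable F n (rcons dims a).
Proof.
case/andP=> m_gt0 le_mn le_n2m size_dims /allP le_dims le_am.
have [s size_s spread_s] := exists_mx_spread_set m_gt0 size_dims.
have le_b : (n - m <= m)%N by lia.
have := mxpackable_of_spread_set le_b spread_s; rewrite subnK // size_s.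
move/mxpackable_leq; apply; rewrite !size_rcons ?size_nseq // => i.
rewrite ltnS !nth_rcons size_nseq nth_nseq; case: ltngtP => // lt_i _.
by rewrite le_dims ?mem_nth.
Qed.

Lemma dims_freedom_cons (q a : nat) (dims : seq nat) :
  dims_freedom q (a :: dims) = (q ^ a - 1 + dims_freedom q dims)%N.
Proof. by rewrite /dims_freedom big_cons. Qed.

Lemma size_mul_leq_dims_freedom (q a : nat) (dims : seq nat) :
    (0 < q)%N -> all (leq a) dims ->
  (size dims * (q ^ a - 1) <= dims_freedom q dims)%N.
Proof.
move=> q_gt0; elim: dims => //= c dims IH /andP[le_ac /IH {}IH].
by rewrite dims_freedom_cons mulSn leq_add // leq_sub2r // leq_pexp2l.
Qed.

Lemma size_leq_exp_of_dims_freedom (q n b m : nat) (dims : seq nat) :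
    (1 < q)%N -> all (ltn b) dims -> (n <= 4 * b)%N -> (n <= m.*2)%N ->
    ((dims_freedom q dims - 1) ^ 4 < q ^ (3 * n))%N ->
  (size dims <= q ^ m)%N.
Proof.
move=> q_gt1 /(size_mul_leq_dims_freedom (ltnW q_gt1)) le_freedom le_n4b le_n2m.
apply: contraTT; rewrite -!leqNgt -ltnNge => lt_size.
have le_pow : (q ^ (m + b) <= dims_freedom q dims - 1)%N.
  have q_b : (0 < q ^ b)%N by rewrite expn_gt0 (ltnW q_gt1).
  by move: le_freedom; rewrite expnD expnS; nia.
apply: leq_trans (_ : (q ^ (m + b)) ^ 4 <= _)%N; last by rewrite leq_exp2r.
by rewrite -expnM leq_exp2l //; lia.
Qed.

Lemma greedy_bound_of_dims_freedom (q n b : nat) (dims : seq nat) :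
    (1 < q)%N -> (4 * b <= n)%N ->
    (dims_freedom q (b.+1 :: dims) <= q ^ n - 1)%N ->
    ((dims_freedom q (b.+1 :: dims) - 1) ^ 4 < q ^ (3 * n))%N ->
  (q ^ b * (1 + dims_freedom q dims) < q ^ n)%N.
Proof.
move=> q_gt1 le_4bn; rewrite dims_freedom_cons.
have le_bn : (b <= n)%N by lia.
have [->|b_gt0] := posnP b; first by rewrite expn1; lia.
move=> _; apply: contraTT; rewrite -!leqNgt -{1}(subnKC le_bn) expnD.
rewrite leq_pmul2l ?expn_gt0 ?(ltnW q_gt1) // => le_pow.
have q_b1 : (2 ^ 2 <= q ^ b.+1)%N.
  by apply: (@leq_trans (q ^ 2)); rewrite ?leq_exp2r ?leq_exp2l.
apply: leq_trans (_ : (q ^ (n - b)) ^ 4 <= _)%N; last by rewrite leq_exp2r; lia.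
by rewrite -expnM leq_exp2l //; lia.
Qed.

Section Packing.

Context {F : finFieldType} {n : nat}.

Lemma mxpackable_large (b : nat) (dims : seq nat) :
    (n <= 4 * b)%N -> sorted leq dims -> all (fun a => (b < a <= n)%N) dims ->
    pairwise (fun a c => (a + c <= n)%N) dims ->
    ((dims_freedom #|F| dims - 1) ^ 4 < #|F| ^ (3 * n))%N ->
  mxpackable F n dims.
Proof.
move=> le_n4b; rewrite (sorted_pairwise leq_trans).
case/lastP: dims => [|dims a]; first by exists [::].
rewrite !pairwise_rcons => /andP[/allP le_a _] b_lt /andP[/allP add_a _] lt_n.
have gt_b : all (ltn b) (rcons dims a) by apply: sub_all b_lt => c /andP[].
move: b_lt; rewrite all_rcons => /andP[/andP[lt_ba le_an] _].
apply: (@mxpackable_rcons_of_spread _ _ (maxn a (uphalf n))); try lia.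
  have le_n2 : (n <= (maxn a (uphalf n)).*2)%N by lia.
  apply: leq_trans (size_leq_exp_of_dims_freedom _ gt_b le_n4b le_n2 lt_n).
    by rewrite size_rcons.
  exact: finNzRing_gt1.
by apply/allP=> c c_dims; have := le_a c c_dims; have := add_a c c_dims; lia.
Qed.

Lemma mxpackable_of_dims_freedom (dims : seq nat) :
    sorted leq dims -> all (fun a => (0 < a <= n)%N) dims ->
    pairwise (fun a c => (a + c <= n)%N) dims ->
    (dims_freedom #|F| dims <= #|F| ^ n - 1)%N ->
    ((dims_freedom #|F| dims - 1) ^ 4 < #|F| ^ (3 * n))%N ->
  mxpackable F n dims.
Proof.
elim: dims => [|[|b] dims IH] //; first by exists [::].
move=> sorted_dims pos_dims add_dims le_n lt_n.
have [small|/ltnW large] := leqP (4 * b) n; last first.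
  have b_min := allP (order_path_min leq_trans sorted_dims).
  apply: mxpackable_large large sorted_dims _ add_dims lt_n.
  apply/allP=> a a_dims; have /andP[_ ->] := allP pos_dims a a_dims.
  by move: a_dims; rewrite andbT inE => /predU1P[-> //|/b_min].
have le_freedom :
    (dims_freedom #|F| dims <= dims_freedom #|F| (b.+1 :: dims))%N.
  by rewrite dims_freedom_cons leq_addl.
have /andP[_ pos_dims'] := pos_dims.
apply: mxpackable_cons.
  apply: IH (path_sorted sorted_dims) pos_dims' _ (leq_trans le_freedom le_n) _.
    by case/andP: add_dims.
  by apply: leq_ltn_trans lt_n; rewrite leq_exp2r // leq_sub2r.
by apply: greedy_bound_of_dims_freedom small le_n lt_n; apply: finNzRing_gt1.
Qed.

End Packing.

Lemma card_mulmx_fiber (F : finFieldType) (m n : nat) (M : 'M[F]_(m, n))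
    (y : 'rV[F]_n) :
  row_full M ->
  #|[set v : 'rV_m | v *m M == y]| = #|[set v : 'rV_m | v *m M == 0]|.
Proof.
case/row_fullP=> B BM.
rewrite -[RHS](card_imset _ (addrI (y *m B))); apply: eq_card => v.
rewrite inE; apply/eqP/imsetP => [vM|[w]].
  exists (v - y *m B); last by rewrite addrC subrK.
  by rewrite inE mulmxBl vM -mulmxA BM mulmx1 subrr.
by rewrite inE => /eqP w0 ->; rewrite mulmxDl w0 addr0 -mulmxA BM mulmx1.
Qed.

Lemma exists_enum_rank_eq (T : finType) (c : nat) :
  (c < #|T|)%N -> exists t : T, forall u, (enum_rank u == c :> nat) = (u == t).
Proof.
move=> lt_c; exists (enum_val (Ordinal lt_c)) => u.
by rewrite -(inj_eq enum_rank_inj) enum_valK.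
Qed.

Lemma card_enum_rank_mulmx_fiber (F : finFieldType) (n r1 r2 a b : nat)
    (M1 : 'M[F]_(n, r1)) (M2 : 'M[F]_(n, r2)) :
    row_full (row_mx M1 M2) -> (a < #|F| ^ r1)%N -> (b < #|F| ^ r2)%N ->
  #|[set v : 'rV_n | (enum_rank (v *m M1) == a :> nat)
                     && (enum_rank (v *m M2) == b :> nat)]|
  = #|[set v : 'rV_n | v *m row_mx M1 M2 == 0]|.
Proof.
rewrite -!card_rV => full.
move=> /exists_enum_rank_eq[y1 y1E] /exists_enum_rank_eq[y2 y2E].
rewrite -(card_mulmx_fiber (row_mx y1 y2) full); apply: eq_card => v.
rewrite !inE y1E y2E mul_mx_row.
by apply/andP/eqP => [[/eqP-> /eqP->] //|/eq_row_mx[-> ->]].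
Qed.

Lemma exists_orthogonal_array_of_index (T : finType) (lv : seq nat)
    (level : 'I_(size lv) -> T -> nat)
    (index : 'I_(size lv) -> 'I_(size lv) -> nat) :
    (forall j t, level j t < nth 0 lv j)%N ->
    (forall (j1 j2 : 'I_(size lv)) a b, j1 != j2 ->
        (a < nth 0 lv j1)%N -> (b < nth 0 lv j2)%N ->
      #|[set t | (level j1 t == a) && (level j2 t == b)]| = index j1 j2) ->
  exists A : 'M[nat]_(#|T|, size lv), orthogonal_array A.
Proof.
move=> level_lt level_index.
pose A := \matrix_(i < #|T|, j < size lv) level j (enum_val i).
exists A; split=> [i j|j1 j2 neq_j]; first by rewrite mxE.
suff countE a b : pair_count A j1 j2 a b
    = #|[set t | (level j1 t == a) && (level j2 t == b)]|.
  by move=> *; rewrite !countE !level_index.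
rewrite /pair_count -(card_imset _ enum_val_inj); apply: eq_card => t.
rewrite inE; apply/imsetP/idP => [[i] | level_t].
  by rewrite inE !mxE => level_i ->.
by exists (enum_rank t); rewrite ?inE ?mxE enum_rankK.
Qed.

Lemma exists_orthogonal_array_of_mxpackable (F : finFieldType) (n : nat)
    (dims : seq nat) (lv := [seq (#|F| ^ a)%N | a <- dims]) :
  mxpackable F n dims ->
  exists A : 'M[nat]_(#|F| ^ n, size lv), orthogonal_array A.
Proof.
case=> fam /(pairwiseP 0) disj rank_fam.
have size_lv : size lv = size fam by rewrite /lv -rank_fam !size_map.
have nth_lv j : (j < size lv)%N ->
    nth 0%N lv j = (#|F| ^ \rank (nth 0%R fam j))%N.
  by rewrite size_lv => lt_j; rewrite /lv -rank_fam -map_comp (nth_map 0).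
have disjoint_cols (j1 j2 : 'I_(size lv)) : j1 != j2 ->
    mxdisjoint (nth 0 fam j1) (nth 0 fam j2).
  rewrite neq_ltn => /orP[|] lt_j; last rewrite mxdisjoint_sym;
    by apply: disj; rewrite ?inE -?size_lv.
pose coord (j : 'I_(size lv)) := (row_base (nth 0%R fam j))^T.
rewrite -card_rV.
pose level (j : 'I_(size lv)) (v : 'rV[F]_n) : nat := enum_rank (v *m coord j).
pose index (j1 j2 : 'I_(size lv)) :=
  #|[set v : 'rV_n | v *m row_mx (coord j1) (coord j2) == 0]|.
apply: (@exists_orthogonal_array_of_index _ lv level index).
  by move=> j v; rewrite nth_lv // (leq_trans (ltn_ord _)) ?card_rV.
move=> j1 j2 a b neq_j; rewrite !nth_lv //.
apply: card_enum_rank_mulmx_fiber.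
apply: row_full_row_mx_disjoint; rewrite ?row_base_free //.
by apply: mxdisjointS (disjoint_cols j1 j2 neq_j); rewrite eq_row_base.
Qed.

Lemma mem_col_levels (ps : symbol) (s : nat) :
  s \in col_levels ps -> exists2 x, x \in ps & x.1 = s.
Proof.
case/flattenP=> _ /mapP[x xps ->]; rewrite mem_nseq => /andP[_ /eqP->].
by exists x.
Qed.

Lemma deg_freedom_col_levels (ps : symbol) :
  deg_freedom ps = (\sum_(s <- col_levels ps) (s - 1))%N.
Proof.
rewrite /deg_freedom big_flatten big_map; apply: eq_bigr => x _.
by rewrite big_nseq iter_addn_0 mulnC.
Qed.

Lemma pairwise_nseq (T : Type) (r : rel T) (n : nat) (x : T) :
  pairwise r (nseq n x) = (n <= 1)%N || r x x.
Proof.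
elim: n => //= -[|n] -> //=; rewrite all_nseq /=.
by case: (r x x); rewrite ?orbT.
Qed.

Lemma pairwise_col_levels (N : nat) (ps : symbol) :
  parameter_set N ps ->
  pairwise (fun s t => (s <= t)%N && (s * t %| N)%N) (col_levels ps).
Proof.
case=> -[sorted_ps _] _ sq_ps mul_ps _.
move: sorted_ps; rewrite (sorted_pairwise ltn_trans).
elim: ps sq_ps mul_ps => // x ps IH sq_ps mul_ps /= /andP[/allP lt_x pw].
rewrite /col_levels /= pairwise_cat; apply/and3P; split.
- apply/allrelP=> s t; rewrite mem_nseq => /andP[_ /eqP->].
  case/mem_col_levels=> y yps <-.
  have lt_xy : (x.1 < y.1)%N by apply: lt_x; apply: map_f.
  rewrite ltnW //= mul_ps ?mem_head ?inE ?yps ?orbT //.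
  by apply: contraTneq lt_xy => ->; rewrite ltnn.
- rewrite pairwise_nseq leqnn mulnn; case: leqP => //= x2_gt1.
  exact: sq_ps (mem_head _ _) x2_gt1.
- apply: IH pw => [y yps|y z yps zps].
    by apply: sq_ps; rewrite inE yps orbT.
  by apply: mul_ps; rewrite inE ?yps ?zps orbT.
Qed.

Lemma realized_prime_power (p e : nat) (ps : symbol) :
    prime p -> parameter_set (p ^ e)%N ps ->
    ((deg_freedom ps - 1) ^ 4 < (p ^ e) ^ 3)%N ->
  realized (p ^ e)%N ps.
Proof.
move=> pr_p ps_N lt_N; have p_gt1 := prime_gt1 pr_p.
have levels_pw := pairwise_col_levels ps_N.
case: ps_N => -[_ wf] dvd_ps _ _ le_N.
have levelP s : s \in col_levels ps ->
    (1 < s)%N /\ exists2 a, (a <= e)%N & s = (p ^ a)%N.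
  case/mem_col_levels=> x xps <-; split; first by case: (wf x xps).
  exact/(dvdn_pfactor _ _ pr_p)/dvd_ps.
pose dims := [seq logn p s | s <- col_levels ps].
have levelsE : col_levels ps = [seq (p ^ a)%N | a <- dims].
  rewrite -map_comp map_id_in // => s /levelP[_ [a _ ->]] /=.
  by rewrite pfactorK.
have freedomE : deg_freedom ps = dims_freedom p dims.
  by rewrite deg_freedom_col_levels levelsE big_map.
move: levels_pw; rewrite levelsE pairwise_map => dims_pw.
rewrite -(card_Fp pr_p) in levelsE freedomE *.
rewrite /realized levelsE; apply: exists_orthogonal_array_of_mxpackable.
apply: mxpackable_of_dims_freedom.
- rewrite (sorted_pairwise leq_trans).
  by apply: sub_pairwise dims_pw => a b /andP[+ _]; rewrite leq_exp2l.
- apply/allP=> _ /mapP[s /levelP[s_gt1 [a le_ae sE]] ->]; move: s_gt1.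
  by rewrite sE pfactorK // le_ae andbT; case: a {le_ae sE}.
- by apply: sub_pairwise dims_pw => a b /andP[_]; rewrite -expnD dvdn_Pexp2l.
- by rewrite -freedomE card_Fp.
- by rewrite -freedomE card_Fp // mulnC expnM.
Qed.

Lemma powR_natdiv_le (R : realType) (x y : R) (m n : nat) :
    (0 < n)%N -> 0 <= x -> 0 <= y -> x ^+ m <= y ^+ n ->
  x `^ (m%:R / n%:R) <= y.
Proof.
move=> n_gt0 x_ge0 y_ge0 le_xy; rewrite -(@ler_pXn2r _ n) ?nnegrE ?powR_ge0 //.
rewrite -powR_mulrn ?powR_ge0 // -powRrM divfK ?powR_mulrn //.
by rewrite pnatr_eq0 -lt0n.
Qed.

Lemma exp3_leq_exp4_pred (N : nat) : (3 < N)%N -> (N ^ 3 <= (N - 1) ^ 4)%N.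
Proof.
move=> N_gt3; rewrite -(@leq_pmul2l (3 ^ 3)) //.
have le3 : ((3 * N) ^ 3 <= (4 * (N - 1)) ^ 3)%N by rewrite leq_exp2r //; lia.
rewrite -expnMn (leq_trans le3) // expnMn (expnS _ 3) mulnA leq_mul2r.
by apply/orP; right; lia.
Qed.

Theorem theorem4 (R : realType) (N : nat)
    (hN : exists p e : nat, [/\ prime p, (0 < e)%N & N = (p ^ e)%N])
    (hN3 : (3 < N)%N) :
  (N%:R : R) `^ (3%:R / 4%:R) <= (threshold N)%:R.
Proof.
apply: powR_natdiv_le; rewrite // -!natrX ler_nat.
have [all_N|not_all] := pselect (all_realized N).
  by rewrite /threshold asboolT ?exp3_leq_exp4_pred.
have [_ [ps [ps_N deg_ps ps_unrealized]]] := thresholdP not_all.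
rewrite leqNgt; apply/negP=> lt_N; apply: ps_unrealized.
have [p [e [pr_p _ NE]]] := hN; rewrite NE in ps_N *.
by apply: realized_prime_power pr_p ps_N _; rewrite -NE deg_ps subn1.
Qed.
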